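(* Let $$A=\begin{bmatrix}0&0&0&1&0&0\\0&0&0&0&b&0\\0&0&0&0&c&e\\0&0&0&0&d&f\\0&0&0&0&0&g\\0&0&0&0&0&h\end{bmatrix},$$ where $b,c,d,e,h\ge0$, $f,g\in\mathbb R$, $f\ge0$ if $ce=0$ and $f\le0$ otherwise, $b^2+c^2+d^2=1$, $e^2+f^2+g^2+h^2=1$, $ce+df=0$, and $c=0$ whenever $e=0$. Assume in addition that $h\ne0$, $d\ne0$ and $c=g=0$. Then $W(A)$ is the circular disk $\{z:|z|\le\sqrt{1+d}/2\}$ if $d\ge2h+h^2$, and otherwise $W(A)$ is the (non-circular) convex hull of $E$ and $\mathcal C_{\sqrt{1+d}/2}$, where $E$ is the ellipse with the foci $0,h$ and major axis of length one.
   Context: $W(A)=\{\langle Ax,x\rangle:\|x\|=1\}$ is the numerical range of $A$. $\mathcal C_r$ is the circle of radius $r$ centered at the origin. In the degenerate case $h=1$ the ellipse $E$ is understood as the pair of its foci $\{0,1\}$. *)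

(* Defs.v *)
From HB Require Import structures.
From mathcomp Require Import all_boot all_order all_algebra.
From mathcomp Require Import spectral complex.
From mathcomp Require Import boolp classical_sets reals convex.

Set Implicit Arguments.
Unset Strict Implicit.
Unset Printing Implicit Defensive.

Import Order.TTheory GRing.Theory Num.Theory.

Local Open Scope classical_set_scope.
Local Open Scope complex_scope.
Local Open Scope ring_scope.

(* [dotmx] is the Hermitian inner product on row vectors, linear in its first
   argument; columns are transposed in order to use it. The norm `|_| that
   matrices carry is the sup norm, hence the explicit square root. *)
Definition inner (R : realType) (n : nat) (x y : 'cV[R[i]]_n) : R[i] :=
  dotmx x^T y^T.

Definition euclidean_norm (R : realType) (n : nat) (x : 'cV[R[i]]_n) : R[i] :=
  sqrtC (inner x x).

Definition numerical_range (R : realType) (n : nat) (A : 'M[R[i]]_n) :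
    set R[i] :=
  [set inner (A *m x) x | x in [set x : 'cV[R[i]]_n | euclidean_norm x = 1]].

(* [Rcomplex R] is R[i] viewed as a vector space over R, so that convex
   combinations have real coefficients in [0, 1]. *)
Definition convex_hull (R : realType) (S : set R[i]) : set R[i] :=
  smallest (@convex_set R (Rcomplex R)) S.

Definition closed_disk (R : realType) (p : R[i]) (r : R) : set R[i] :=
  [set z | `|z - p| <= r%:C].

Definition origin_circle (R : realType) (r : R) : set R[i] :=
  [set z | `|z| = r%:C].

(* The ellipse (as a curve) with foci [p], [q] and major axis of length [l].
   When the foci are at distance [l] it is, by convention, reduced to them. *)
Definition ellipse (R : realType) (p q : R[i]) (l : R) : set R[i] :=
  if `|p - q| == l%:C then [set p; q]
  else [set z | `|z - p| + `|z - q| = l%:C].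

Definition matrixA (R : realType) (b c d e f g h : R) : 'M[R[i]]_6 :=
  \matrix_(i < 6, j < 6)
    (nth 0 (nth [::]
      [:: [:: 0; 0; 0; 1; 0; 0];
          [:: 0; 0; 0; 0; b; 0];
          [:: 0; 0; 0; 0; c; e];
          [:: 0; 0; 0; 0; d; f];
          [:: 0; 0; 0; 0; 0; g];
          [:: 0; 0; 0; 0; 0; h]] i) j)%:C.

(* Main.v *)
Require Import Defs.
From mathcomp Require Import all_boot all_order all_algebra.
From mathcomp Require Import complex spectral ring lra.
From mathcomp Require Import classical_sets reals convex interval_inference.

Import Order.TTheory GRing.Theory Num.Theory.
Local Open Scope classical_set_scope.
Local Open Scope complex_scope.
Local Open Scope ring_scope.

Import Normc.

(** Since [c = 0], [d <> 0] and [c e + d f = 0], also [f = 0], and after a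
permutation of the coordinates the matrix splits as the direct sum of a
nilpotent 4 x 4 block on the coordinates 1, 2, 4, 5 and of the 2 x 2 block
with rows [(0, e)] and [(0, h)] on the coordinates 3, 6.

The form of the nilpotent block is supported on the path 1 - 4 - 5 - 2 with
weights [1, d, b]. Its modulus is largest when all phases are aligned, and half
the largest eigenvalue of the weighted path is then the radius
[r = sqrt (1 + d) / 2]; rotating the phases along the path shows that the whole
disk of radius [r] is attained ([form_nil_le], [form_nil_surj]). The numerical
range of the 2 x 2 block is the elliptical disk with foci [0, h] and major axis
of length 1 ([form_ell_le], [form_ell_surj]).

The numerical range of the sum is then the join of these two convex sets. It
is written [join_range] as the set of sums [w1 + w2] in which a mass [a] is
given to the first block and [1 - a] to the second one, the constraints on
[w1] and [w2] being homogeneous in the masses. In this form convexity is just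
the triangle inequality, and no separate argument is needed for the convexity
of the numerical range.

A point [z] of the elliptical disk satisfies [|z| <= (1 + h) / 2], with equality
at the right vertex. So the disk of radius [r] contains the elliptical disk
exactly when [1 + h <= sqrt (1 + d)], that is [2 h + h^2 <= d]. In all cases the
join is the convex hull of the two curves, because each point of either region
lies on a vertical chord ([join_range_hull]). If [d < 2 h + h^2] it is not a
disk: it contains [i r] and [- i r] and lies in the strip [|Im z| <= r], which
leaves only the disk of radius [r] centered at the origin, and the right vertex
is outside that one ([join_range_not_disk]). *)

(** * The modulus of a complex number *)

Lemma normr_normc (R : realType) (z : R[i]) : `|z| = (normc z)%:C.
Proof. by rewrite normc_def; case: z. Qed.

Lemma sqr_normc_ReIm (R : realType) (z : R[i]) :
  normc z ^+ 2 = complex.Re z ^+ 2 + complex.Im z ^+ 2.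
Proof. by case: z => x y /=; rewrite sqr_sqrtr // addr_ge0 ?sqr_ge0. Qed.

Lemma normc_ge0 (R : realType) (z : R[i]) : 0 <= normc z.
Proof. by case: z => x y /=; rewrite sqrtr_ge0. Qed.

Lemma normc_conj (R : realType) (z : R[i]) : normc z^*%C = normc z.
Proof. by case: z => x y /=; rewrite sqrrN. Qed.

Lemma normc_real (R : realType) (x : R) : 0 <= x -> normc x%:C = x.
Proof. by move=> x0; rewrite /= expr0n addr0 sqrtr_sqr ger0_norm. Qed.

Lemma mulcJ (R : realType) (z : R[i]) : z * z^*%C = (normc z ^+ 2)%:C.
Proof.
by rewrite sqr_normc_ReIm; case: z => x y; simpc; congr (_ +i* _); ring.
Qed.

(** * The numerical range as the range of a form *)

Lemma innerE (R : realType) (n : nat) (x y : 'cV[R[i]]_n) :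
  inner x y = \sum_i x i 0 * (y i 0)^*%C.
Proof.
by rewrite /inner dotmxE mxE; apply: eq_bigr => i _; rewrite !mxE.
Qed.

Lemma euclidean_norm1P (R : realType) (n : nat) (x : 'cV[R[i]]_n) :
  euclidean_norm x = 1 <-> \sum_i normc (x i 0) ^+ 2 = 1.
Proof.
have E : inner x x = (\sum_i normc (x i 0) ^+ 2)%:C.
  by rewrite innerE rmorph_sum; apply: eq_bigr => i _; rewrite mulcJ.
rewrite /euclidean_norm E; split => [H|->]; last exact: sqrtC1.
by apply: complexI; rewrite -[LHS]sqrtCK H expr1n.
Qed.

(** The form [<A x, x>] restricted to the coordinates 1, 2, 4, 5. *)
Definition form_nil {R : realType} (b d : R) (x1 x2 x4 x5 : R[i]) : R[i] :=
  x4 * x1^*%C + b%:C * x5 * x2^*%C + d%:C * x5 * x4^*%C.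

(** The form [<A x, x>] restricted to the coordinates 3, 6. *)
Definition form_ell {R : realType} (e h : R) (x3 x6 : R[i]) : R[i] :=
  e%:C * x6 * x3^*%C + h%:C * x6 * x6^*%C.

Lemma sum_ord6 (V : nmodType) (F : 'I_6 -> V) :
  \sum_i F i = F (inord 0) + F (inord 1) + F (inord 2) + F (inord 3)
    + F (inord 4) + F (inord 5).
Proof.
rewrite (eq_bigr (fun i : 'I_6 => (fun j => F (inord j)) (val i))) => [|i _].
  by rewrite !big_ord_recr big_ord0 /= add0r.
by rewrite inord_val.
Qed.

(** In the norm constraint the masses of the two blocks are kept apart. *)
Lemma numerical_rangeP (R : realType) (b d e h : R) (z : R[i]) :
  numerical_range (matrixA b 0 d e 0 0 h) z <->
  exists x1 x2 x3 x4 x5 x6 : R[i],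
    (normc x1 ^+ 2 + normc x2 ^+ 2 + normc x4 ^+ 2 + normc x5 ^+ 2)
      + (normc x3 ^+ 2 + normc x6 ^+ 2) = 1 /\
    z = form_nil b d x1 x2 x4 x5 + form_ell e h x3 x6.
Proof.
have normE (v : 'cV[R[i]]_6) : euclidean_norm v = 1 <->
    (normc (v (inord 0) 0) ^+ 2 + normc (v (inord 1) 0) ^+ 2
      + normc (v (inord 3) 0) ^+ 2 + normc (v (inord 4) 0) ^+ 2)
      + (normc (v (inord 2) 0) ^+ 2 + normc (v (inord 5) 0) ^+ 2) = 1.
  rewrite euclidean_norm1P sum_ord6.
  by split=> <-; ring.
have formE (v : 'cV[R[i]]_6) : inner (matrixA b 0 d e 0 0 h *m v) v =
    form_nil b d (v (inord 0) 0) (v (inord 1) 0) (v (inord 3) 0) (v (inord 4) 0)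
    + form_ell e h (v (inord 2) 0) (v (inord 5) 0).
  rewrite innerE sum_ord6 !mxE !sum_ord6 !mxE !inordK //= /form_nil /form_ell.
  by rewrite !rmorph0 rmorph1; ring.
split=> [[v /normE v1 <-]|[x1 [x2 [x3 [x4 [x5 [x6 [x1E ->]]]]]]]].
  rewrite formE; do 6 eexists; split; last reflexivity.
  exact: v1.
pose v : 'cV[R[i]]_6 := \col_i nth 0 [:: x1; x2; x3; x4; x5; x6] i.
exists v; last by rewrite formE !mxE !inordK.
by apply/normE; rewrite !mxE !inordK.
Qed.

(** * The nilpotent block *)

Lemma conjcM (R : realType) (x y : R[i]) :
  (x * y)^*%C = x^*%C * y^*%C.
Proof. exact: rmorphM. Qed.

Lemma realcM (R : realType) (x y : R) : (x * y)%:C = x%:C * y%:C.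
Proof. exact: rmorphM. Qed.

Lemma complex_polar {R : realType} (w : R[i]) :
  exists2 u : R[i], normc u = 1 & w = (normc w)%:C * u.
Proof.
have [->|w0] := eqVneq w 0; first by exists 1; rewrite ?normc1 // normc0 mul0r.
have nw0 : normc w != 0 by apply: contra_neq w0; exact: eq0_normc.
exists ((normc w)^-1%:C * w).
  by rewrite normcM normc_real ?invr_ge0 ?normc_ge0 // mulVf.
by rewrite mulrA -rmorphM mulfV // mul1r.
Qed.

(** The numbers [lam] and [mu] make [(1, mu, lam, 1)] an eigenvector, on the
coordinates 1, 2, 4, 5, of the weighted path, for the eigenvalue [lam]. *)
Lemma nil_weights {R : realType} {b d : R} :
    0 <= b -> 0 <= d -> b ^+ 2 + d ^+ 2 = 1 ->
  exists lam mu : R, [/\ lam = Num.sqrt (1 + d), 0 < lam & lam ^+ 2 = 1 + d] /\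
    [/\ 0 <= mu, mu ^+ 2 = 1 - d & b = lam * mu].
Proof.
move=> b_ge0 d_ge0 bd1.
have d_le1 : d <= 1 by rewrite -(@expr_le1 _ 2) // -bd1 lerDr sqr_ge0.
exists (Num.sqrt (1 + d)), (Num.sqrt (1 - d)); split; split=> //.
- by rewrite sqrtr_gt0; lra.
- by rewrite sqr_sqrtr //; lra.
- by rewrite sqr_sqrtr //; lra.
rewrite -sqrtrM; last by lra.
have -> : (1 + d) * (1 - d) = b ^+ 2.
  by rewrite -[b ^+ 2](addrK (d ^+ 2)) bd1; ring.
by rewrite sqrtr_sqr ger0_norm.
Qed.

Lemma form_nil_le (R : realType) (b d : R) (x1 x2 x4 x5 : R[i]) :
    0 <= b -> 0 <= d -> b ^+ 2 + d ^+ 2 = 1 ->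
  normc (form_nil b d x1 x2 x4 x5) <= Num.sqrt (1 + d) / 2 *
    (normc x1 ^+ 2 + normc x2 ^+ 2 + normc x4 ^+ 2 + normc x5 ^+ 2).
Proof.
move=> b_ge0 d_ge0 bd1.
have [lam [mu [[lamE lam_gt0 lam2] [mu_ge0 mu2 bE]]]] :=
  nil_weights b_ge0 d_ge0 bd1.
apply: le_trans (le_normcD _ _) _.
apply: le_trans (lerD (le_normcD _ _) (lexx _)) _.
rewrite !normcM !normc_conj !normc_real // -lamE bE.
move: (normc x1) (normc x2) (normc x4) (normc x5) => p1 p2 p4 p5.
pose q := p4 / lam; have -> : p4 = lam * q by rewrite mulrC divfK // gt_eqF.
(* The defect is a weighted sum of squares that vanishes on the eigenvector. *)
rewrite -subr_ge0.
set D := (X in 0 <= X).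
have -> : D = lam / 2 *
    ((p1 - q) ^+ 2 + d * (p5 - q) ^+ 2 + (mu * p5 - p2) ^+ 2).
  by rewrite /D !(sqrrB, exprMn) lam2 mu2; field; rewrite gt_eqF.
apply: mulr_ge0; first by lra.
by rewrite !addr_ge0 ?(mulr_ge0 d_ge0) ?sqr_ge0.
Qed.

Lemma form_nil_surj {R : realType} {b d a : R} {w : R[i]} :
    0 <= b -> 0 <= d -> b ^+ 2 + d ^+ 2 = 1 ->
  normc w <= Num.sqrt (1 + d) / 2 * a ->
  exists x1 x2 x4 x5 : R[i],
    normc x1 ^+ 2 + normc x2 ^+ 2 + normc x4 ^+ 2 + normc x5 ^+ 2 = a /\
    form_nil b d x1 x2 x4 x5 = w.
Proof.
move=> b_ge0 d_ge0 bd1.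
have [lam [mu [[lamE lam_gt0 lam2] [mu_ge0 mu2 bE]]]] :=
  nil_weights b_ge0 d_ge0 bd1.
rewrite -lamE => wa; have [u u1 ->] := complex_polar w.
have [k wE] : exists k, normc w = lam * k.
  by exists (normc w / lam); rewrite mulrC divfK // gt_eqF.
have k_ge0 : 0 <= k by rewrite -(pmulr_rge0 _ lam_gt0) -wE normc_ge0.
have ka : k <= a / 2 by rewrite -(ler_pM2l lam_gt0) -wE; lra.
(* [X] and [Y] are the half sum and half difference of the square roots of
   [a / 2 + k] and [a / 2 - k]. *)
have [X [Y [X_ge0 Y_ge0 XY2 XY]]] : exists X Y : R,
    [/\ 0 <= X, 0 <= Y, X ^+ 2 + Y ^+ 2 = a / 2 & X * Y = k / 2].
  have S2 : Num.sqrt (a / 2 + k) ^+ 2 = a / 2 + k by rewrite sqr_sqrtr //; lra.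
  have T2 : Num.sqrt (a / 2 - k) ^+ 2 = a / 2 - k by rewrite sqr_sqrtr //; lra.
  have TS : Num.sqrt (a / 2 - k) <= Num.sqrt (a / 2 + k).
    by apply: ler_wsqrtr; lra.
  have S_ge0 := sqrtr_ge0 (a / 2 + k); have T_ge0 := sqrtr_ge0 (a / 2 - k).
  move: (Num.sqrt (a / 2 + k)) (Num.sqrt (a / 2 - k)) S2 T2 TS S_ge0 T_ge0.
  move=> S T S2 T2 TS S_ge0 T_ge0.
  by exists ((S + T) / 2), ((S - T) / 2); split; nra.
(* The moduli [(X, mu Y, lam Y, X)] give the form the modulus [2 lam X Y], and
   the phases [1, u, u, u^2] give each of its three terms the phase [u]. *)
exists X%:C, (u * (mu * Y)%:C), (u * (lam * Y)%:C), (u ^+ 2 * X%:C).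
have lamY_ge0 : 0 <= lam * Y by rewrite mulr_ge0 // ltW.
have muY_ge0 : 0 <= mu * Y by rewrite mulr_ge0.
split.
  rewrite !normcM u1 !normc_real // !mul1r !exprMn lam2 mu2.
  by nra.
have uu : u * u^*%C = 1 by rewrite mulcJ u1 expr1n.
rewrite /form_nil !conjcM !conjc_real.
rewrite bE wE !realcM.
transitivity (u * ((lam * (1 + mu ^+ 2 + d))%:C * (X * Y)%:C)); last first.
  by rewrite mu2 XY -!realcM [LHS]mulrC; congr (_%:C * _); field.
transitivity (u * lam%:C * X%:C * Y%:C *
    (1 + mu%:C ^+ 2 * (u * u^*%C) + d%:C * (u * u^*%C))); first by ring.
by rewrite uu !realcM !rmorphD rmorphXn rmorph1 /=; ring.
Qed.

(** * The elliptical block *)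

Lemma form_ell_le (R : realType) (e h : R) (x3 x6 : R[i]) :
    e ^+ 2 + h ^+ 2 = 1 ->
  normc (form_ell e h x3 x6)
    + normc (form_ell e h x3 x6 - (h * (normc x3 ^+ 2 + normc x6 ^+ 2))%:C)
    <= normc x3 ^+ 2 + normc x6 ^+ 2.
Proof.
move=> eh1.
have -> : form_ell e h x3 x6 - (h * (normc x3 ^+ 2 + normc x6 ^+ 2))%:C
    = x3^*%C * (e%:C * x6 - h%:C * x3).
  by rewrite realcM rmorphD /= -!mulcJ /form_ell; ring.
have -> : form_ell e h x3 x6 = x6 * (e%:C * x3^*%C + h%:C * x6^*%C).
  by rewrite /form_ell; ring.
rewrite !normcM normc_conj.
(* The real matrix with rows [(e, h)] and [(-h, e)] is orthogonal; conjugating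
   does not change the modulus. *)
have unitary : normc (e%:C * x3^*%C + h%:C * x6^*%C) ^+ 2
    + normc (e%:C * x6 - h%:C * x3) ^+ 2 = normc x3 ^+ 2 + normc x6 ^+ 2.
  rewrite !sqr_normc_ReIm; case: x3 x6 => [u v] [s t] /=.
  rewrite -[RHS]mul1r -eh1; ring.
have := sqr_ge0 (normc x6 - normc (e%:C * x3^*%C + h%:C * x6^*%C)).
have := sqr_ge0 (normc x3 - normc (e%:C * x6 - h%:C * x3)).
by rewrite !sqrrB; lra.
Qed.

(** When [k = 0] the hypothesis forces [v = 0], so no assumption on [k] is
needed. *)
Lemma sqr_normc_mulr_surj (R : realType) (k n : R) (v : R[i]) :
  0 <= n -> normc v ^+ 2 = k ^+ 2 * n ->
  exists x : R[i], normc x ^+ 2 = n /\ k%:C * x^*%C = v.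
Proof.
move=> n_ge0 vE; have [k0|k0] := eqVneq k 0.
  have v0 : v = 0.
    by apply: eq0_normc; apply/eqP; rewrite -sqrf_eq0 vE k0 expr0n mul0r.
  exists (Num.sqrt n)%:C; rewrite normc_real ?sqrtr_ge0 // sqr_sqrtr //.
  by rewrite k0 v0 mul0r.
exists ((k^-1)%:C * v^*%C); split.
  apply: (mulfI (expf_neq0 2 k0)); rewrite -vE !sqr_normc_ReIm.
  by case: v {vE} => s t /=; field.
rewrite conjcM conjcK conjc_real mulrA -realcM mulfV //.
by rewrite mul1r.
Qed.

Lemma form_ell_surj {R : realType} {e h a : R} {w : R[i]} :
    e ^+ 2 + h ^+ 2 = 1 ->
    normc w + normc (w - (h * a)%:C) <= a ->
  exists x3 x6 : R[i],
    normc x3 ^+ 2 + normc x6 ^+ 2 = a /\ form_ell e h x3 x6 = w.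
Proof.
move=> eh1 wa; have e2 : e ^+ 2 = 1 - h ^+ 2 by rewrite -eh1 addrK.
have p_ge0 := normc_ge0 _ w; have q_ge0 := normc_ge0 _ (w - (h * a)%:C).
have a_ge0 : 0 <= a by lra.
have p2 := sqr_normc_ReIm _ w; have q2 := sqr_normc_ReIm _ (w - (h * a)%:C).
(* With [x6] real and [x6^2 = m], solving [form_ell e h x3 x6 = w] for [x3] of
   square modulus [a - m] requires [|w - h m|^2 = e^2 m (a - m)], a quadratic
   equation in [m]. *)
have surj m : 0 <= m -> m <= a ->
    m ^+ 2 - m * (2 * h * complex.Re w + e ^+ 2 * a) + normc w ^+ 2 = 0 ->
    exists x3 x6 : R[i],
      normc x3 ^+ 2 + normc x6 ^+ 2 = a /\ form_ell e h x3 x6 = w.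
  move=> m_ge0 ma root_m.
  have sm2 : Num.sqrt m ^+ 2 = m by rewrite sqr_sqrtr.
  have := @sqr_normc_mulr_surj R (e * Num.sqrt m) (a - m) (w - (h * m)%:C).
  rewrite subr_ge0 => /(_ ma) [|x3 [x3E wE]].
    rewrite exprMn sm2 sqr_normc_ReIm; move: p2 root_m.
    case: (w) => s t /= -> root_m.
    apply/eqP; rewrite -subr_eq0; apply/eqP.
    by rewrite -[RHS]root_m e2; ring.
  exists x3, (Num.sqrt m)%:C; rewrite normc_real ?sqrtr_ge0 // sm2 x3E.
  split; first by ring.
  rewrite /form_ell conjc_real -[RHS](subrK (h * m)%:C) -wE.
  by rewrite -[m in (h * m)%:C]sm2 expr2 !realcM; ring.
set S := 2 * h * complex.Re w + e ^+ 2 * a in surj.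
have [a0|a_gt0] := leP a 0.
  have -> : w = 0 by apply: eq0_normc; lra.
  exists 0, 0; rewrite normc0 /form_ell !mulr0 mul0r addr0; split=> //.
  by rewrite expr0n /= addr0; lra.
(* The two bounds below make the roots real and put the smaller one between 0
   and [a]. *)
have Sp : 2 * normc w <= S.
  have qa : normc (w - (h * a)%:C) ^+ 2 <= (a - normc w) ^+ 2.
    by rewrite lerXn2r ?nnegrE //; lra.
  rewrite -(ler_pM2l a_gt0) /S e2; move: p2 q2 qa.
  by case: (w) => s t /= p2 q2 qa; nra.
have Sq : 2 * normc (w - (h * a)%:C) <= 2 * a - S.
  have pa : normc w ^+ 2 <= (a - normc (w - (h * a)%:C)) ^+ 2.
    by rewrite lerXn2r ?nnegrE //; lra.
  rewrite -(ler_pM2l a_gt0) /S e2; move: p2 q2 pa.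
  by case: (w) => s t /= p2 q2 pa; nra.
have disc_ge0 : 0 <= S ^+ 2 - 4 * normc w ^+ 2 by nra.
have D2 : Num.sqrt (S ^+ 2 - 4 * normc w ^+ 2) ^+ 2 = S ^+ 2 - 4 * normc w ^+ 2.
  by rewrite sqr_sqrtr.
have D_ge0 := sqrtr_ge0 (S ^+ 2 - 4 * normc w ^+ 2).
move: (Num.sqrt _) D2 D_ge0 => D D2 D_ge0.
have DS : D <= S by nra.
by apply: (surj ((S - D) / 2)); nra.
Qed.

(** * The join of the disk and the elliptical disk *)

(** For [0 <= r] and [0 <= h <= 1], the union of the segments joining a point
of the disk of radius [r] to a point of the elliptical disk with foci [0, h] and
major axis of length 1. The weights [a] and [1 - a] are absorbed into [w1] and
[w2], so that the cases [a = 0] and [a = 1] need no division. *)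
Definition join_range {R : realType} (h r : R) : set R[i] :=
  [set z | exists (a : R) (w1 w2 : R[i]),
    [/\ 0 <= a <= 1, normc w1 <= r * a,
      normc w2 + normc (w2 - (h * (1 - a))%:C) <= 1 - a & z = w1 + w2]].

Lemma numerical_range_join (R : realType) (b d e h : R) :
    0 <= b -> 0 <= d -> b ^+ 2 + d ^+ 2 = 1 -> e ^+ 2 + h ^+ 2 = 1 ->
  numerical_range (matrixA b 0 d e 0 0 h)
    = join_range h (Num.sqrt (1 + d) / 2).
Proof.
move=> b_ge0 d_ge0 bd1 eh1; apply/seteqP; split=> z.
  move/numerical_rangeP=> [x1 [x2 [x3 [x4 [x5 [x6 [x1E ->]]]]]]].
  exists (normc x1 ^+ 2 + normc x2 ^+ 2 + normc x4 ^+ 2 + normc x5 ^+ 2).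
  exists (form_nil b d x1 x2 x4 x5), (form_ell e h x3 x6).
  split=> //; last 2 first.
  - exact: form_nil_le.
  - rewrite (_ : 1 - _ = normc x3 ^+ 2 + normc x6 ^+ 2); last first.
      by rewrite -x1E [LHS]addrC addKr.
    exact: form_ell_le.
  - by rewrite -[X in _ <= _ <= X]x1E lerDl !addr_ge0 ?sqr_ge0.
move=> [a [w1 [w2 [/andP[a_ge0 a_le1] w1a w2a ->]]]].
have [x1 [x2 [x4 [x5 [aE <-]]]]] := form_nil_surj b_ge0 d_ge0 bd1 w1a.
have [x3 [x6 [a'E <-]]] := form_ell_surj eh1 w2a.
apply/numerical_rangeP; exists x1, x2, x3, x4, x5, x6.
by rewrite aE a'E; split=> //; ring.
Qed.

Lemma RcomplexZ (R : realType) (t : R) (x : Rcomplex R) : t *: x = t%:C * x.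
Proof. by case: x => u v; simpc. Qed.

Lemma normc_convex {R : realType} {t : R} {x y : R[i]} : 0 <= t <= 1 ->
  normc (t%:C * x + (1 - t)%:C * y) <= t * normc x + (1 - t) * normc y.
Proof.
move=> /andP[t_ge0 t_le1]; apply: le_trans (le_normcD _ _) _.
by rewrite !normcM !normc_real // subr_ge0.
Qed.

Lemma convex_setP (R : realType) (S : set R[i]) :
  @convex_set R (Rcomplex R) S <->
  forall (t : R) x y, 0 <= t <= 1 -> S x -> S y ->
    S (t%:C * x + (1 - t)%:C * y).
Proof.
split=> [cS t x y t01 Sx Sy|cS x y t].
  have /set_mem := cS x y
    (Itv01 (proj1 (andP t01)) (proj2 (andP t01))) (mem_set Sx) (mem_set Sy).
  by rewrite /conv /= !RcomplexZ.
rewrite !inE => Sx Sy; rewrite /conv /= !RcomplexZ.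
by apply: cS => //; rewrite ge0 le1.
Qed.

Lemma convex_join_range (R : realType) (h r : R) :
  @convex_set R (Rcomplex R) (join_range h r).
Proof.
apply/convex_setP => t x y t01 [a [w1 [w2 [a01 w1a w2a ->]]]].
move=> [a' [w1' [w2' [a'01 w1'a w2'a ->]]]].
exists (t * a + (1 - t) * a'), (t%:C * w1 + (1 - t)%:C * w1'),
  (t%:C * w2 + (1 - t)%:C * w2'); split.
- by nra.
- by apply: le_trans (normc_convex t01) _; nra.
- have -> : t%:C * w2 + (1 - t)%:C * w2'
      - (h * (1 - (t * a + (1 - t) * a')))%:C
    = t%:C * (w2 - (h * (1 - a))%:C) + (1 - t)%:C * (w2' - (h * (1 - a'))%:C).
    rewrite !mulrBr [RHS]addrACA -opprD -!realcM -rmorphD.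
    by congr (_ - _%:C); ring.
  apply: le_trans (lerD (normc_convex t01) (normc_convex t01)) _.
  by nra.
- by ring.
Qed.

(** * Filling the circle and the ellipse by vertical chords *)

Lemma convex_hull_conv (R : realType) (S : set R[i]) (t : R) (x y : R[i]) :
    0 <= t <= 1 -> convex_hull S x -> convex_hull S y ->
  convex_hull S (t%:C * x + (1 - t)%:C * y).
Proof.
move=> t01 Sx Sy A [cA SA]; have /convex_setP := cA.
by apply=> //; [apply: Sx|apply: Sy].
Qed.

Lemma convex_hull_chord (R : realType) (S : set R[i]) (x y k : R) :
    S (x +i* k) -> S (x -i* k) -> y ^+ 2 <= k ^+ 2 ->
  convex_hull S (x +i* y).
Proof.
move=> Sk SNk yk.
(* If [k = 0] then [y = 0], and [y / k = 0] gives the harmless [t = 1 / 2]. *)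
pose t := (1 + y / k) / 2.
have t01 : 0 <= t <= 1.
  have : `|y / k| <= 1.
    rewrite normf_div; have [->|k0] := eqVneq k 0.
      by rewrite normr0 invr0 mulr0 ler01.
    rewrite ler_pdivrMr ?normr_gt0 // mul1r -ler_sqr ?nnegrE //.
    by rewrite !real_normK ?num_real.
  by rewrite ler_norml /t; lra.
have -> : x +i* y = t%:C * (x +i* k) + (1 - t)%:C * (x -i* k).
  have yE : y / k * k = y.
    have [k0|k0] := eqVneq k 0; last by rewrite divfK.
    move: yk; rewrite k0 expr0n /= real_exprn_even_le0 ?num_real //= mulr0.
    by move=> /eqP.
  apply/eqP; rewrite eq_complex /= -{1}yE /t.
  move: (y / k) => q; by apply/andP; split; apply/eqP; field.
by apply: convex_hull_conv => // A [_]; apply.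
Qed.

Lemma disk_sub_hull {R : realType} {r : R} {z : R[i]} : 0 <= r ->
  normc z <= r -> convex_hull (origin_circle r) z.
Proof.
move=> r_ge0 zr.
have : normc z ^+ 2 <= r ^+ 2 by rewrite lerXn2r ?nnegrE ?normc_ge0.
rewrite sqr_normc_ReIm; case: z {zr} => x y /= zr.
have k2 : Num.sqrt (r ^+ 2 - x ^+ 2) ^+ 2 = r ^+ 2 - x ^+ 2.
  by rewrite sqr_sqrtr; have := sqr_ge0 y; lra.
apply: (@convex_hull_chord _ _ x y (Num.sqrt (r ^+ 2 - x ^+ 2))).
- rewrite /origin_circle /= normr_normc /= k2 addrC subrK.
  by rewrite sqrtr_sqr ger0_norm.
- rewrite /origin_circle /= normr_normc /= sqrrN k2 addrC subrK.
  by rewrite sqrtr_sqr ger0_norm.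
- by rewrite k2; lra.
Qed.

Lemma normc_ge_absRe {R : realType} (z : R[i]) : `|complex.Re z| <= normc z.
Proof. by rewrite -lecR -normr_normc normc_ge_Re. Qed.

(** For [h = 1] the ellipse is reduced to its foci, and the elliptical disk is
the segment between them. *)
Lemma elliptical_disk_sub_hull {R : realType} {h : R} {z : R[i]} :
    0 < h <= 1 -> normc z + normc (z - h%:C) <= 1 ->
  convex_hull (ellipse 0 h%:C 1) z.
Proof.
move=> /andP[h_gt0 h_le1] z1.
have p2 := sqr_normc_ReIm _ z; have q2 := sqr_normc_ReIm _ (z - h%:C).
have p0 := normc_ge0 _ z; have q0 := normc_ge0 _ (z - h%:C).
(* Squaring twice gives the Cartesian inequality of the elliptical disk. *)
have quad : 4 * complex.Im z ^+ 2
    <= (1 - h ^+ 2) * (1 - (2 * complex.Re z - h) ^+ 2).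
  have qp : normc (z - h%:C) ^+ 2 <= (1 - normc z) ^+ 2.
    by rewrite lerXn2r ?nnegrE //; lra.
  have pS : 2 * normc z <= 1 - h ^+ 2 + 2 * h * complex.Re z.
    by move: p2 q2 qp; case: (z) => x y /= p2 q2 qp; nra.
  have : (2 * normc z) ^+ 2 <= (1 - h ^+ 2 + 2 * h * complex.Re z) ^+ 2.
    by rewrite lerXn2r ?nnegrE //; lra.
  by rewrite exprMn p2; lra.
have [xl xr] : h - 1 <= 2 * complex.Re z /\ 2 * complex.Re z <= 1 + h.
  have := normc_ge_absRe z; have := normc_ge_absRe (z - h%:C).
  move: z1; case: (z) => x y /=.
  rewrite !ler_norml => z1 /andP[a1 a2] /andP[a3 a4]; lra.
rewrite /ellipse sub0r normrN normr_normc normc_real 1?ltW //.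
case: (eqVneq h 1) => [h1|h_neq1].
  rewrite h1 eqxx; move: quad xl xr; case: z {z1 p2 q2 p0 q0} => x y /=.
  rewrite h1 => quad xl xr; have -> : y = 0 by nra.
  have -> : x +i* 0 = x%:C * 1 + (1 - x)%:C * 0 by rewrite mulr0 addr0 mulr1.
  apply: convex_hull_conv; first by lra.
    by move=> A [_]; apply; right.
  by move=> A [_]; apply; left.
have -> : (h%:C == 1%:C :> R[i]) = false.
  by apply/negP => /eqP /complexI/eqP; rewrite (negbTE h_neq1).
move: quad xl xr; case: z {z1 p2 q2 p0 q0} => x y /= quad xl xr.
set K := (1 - h ^+ 2) * (1 - (2 * x - h) ^+ 2) in quad.
have k2 : (Num.sqrt K / 2) ^+ 2 = K / 4.
  rewrite exprMn sqr_sqrtr; first by field.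
  by have := sqr_ge0 y; lra.
(* On the ellipse the distances to the foci are affine functions of [x], whose
   squares appear below. *)
have on_ellipse (k : R) : k ^+ 2 = K / 4 ->
    [set z : R[i] | `|z - 0| + `|z - h%:C| = 1%:C] (x +i* k).
  move=> kK /=; rewrite subr0 !normr_normc -rmorphD; congr _%:C.
  rewrite /= subr0 kK.
  have -> : x ^+ 2 + K / 4 = ((1 - h ^+ 2 + 2 * h * x) / 2) ^+ 2.
    by rewrite /K; field.
  have -> : (x - h) ^+ 2 + K / 4 = ((1 + h ^+ 2 - 2 * h * x) / 2) ^+ 2.
    by rewrite /K; field.
  rewrite !sqrtr_sqr !ger0_norm; [by field|nra|nra].
apply: (@convex_hull_chord _ _ x y (Num.sqrt K / 2)).
- by apply: on_ellipse.
- by apply: on_ellipse; rewrite sqrrN.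
- by rewrite k2; lra.
Qed.

(** * Shape of the join *)

Lemma normc_imag (R : realType) (x : R) : normc (0 +i* x) = `|x|.
Proof. by rewrite /= expr0n add0r sqrtr_sqr. Qed.

Lemma normc_ge_absIm {R : realType} (z : R[i]) : `|complex.Im z| <= normc z.
Proof.
rewrite -ler_sqr ?nnegrE ?normc_ge0 // real_normK ?num_real //.
by rewrite sqr_normc_ReIm lerDr sqr_ge0.
Qed.

Lemma disk_sub_join {R : realType} {h r : R} {z : R[i]} :
  normc z <= r -> join_range h r z.
Proof.
move=> zr; exists 1, z, 0; rewrite subrr mulr0 subr0 !normc0 addr0 mulr1.
by split; rewrite ?addr0 ?lexx ?ler01.
Qed.

Lemma elliptical_disk_sub_join {R : realType} {h r : R} {z : R[i]} :
  normc z + normc (z - h%:C) <= 1 -> join_range h r z.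
Proof.
move=> z1; exists 0, 0, z; rewrite subr0 mulr0 !mulr1 normc0 add0r.
by split; rewrite ?lexx ?ler01.
Qed.

Lemma join_range_hull (R : realType) (h r : R) : 0 < h <= 1 -> 0 <= r ->
  join_range h r = convex_hull (ellipse 0 h%:C 1 `|` origin_circle r).
Proof.
move=> h01 r_ge0; have /andP[h_gt0 h_le1] := h01; apply/seteqP; split=> z.
  move=> [a [w1 [w2 [/andP[a_ge0 a_le1] w1a w2a ->]]]].
  have hullE w : normc w + normc (w - h%:C) <= 1 ->
      convex_hull (ellipse 0 h%:C 1 `|` origin_circle r) w.
    move=> /(elliptical_disk_sub_hull h01) Ew A [cA SA].
    by apply: Ew; split=> // x Ex; apply: SA; left.
  have hullC w : normc w <= r ->
      convex_hull (ellipse 0 h%:C 1 `|` origin_circle r) w.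
    move=> /(disk_sub_hull r_ge0) Cw A [cA SA].
    by apply: Cw; split=> // x Cx; apply: SA; right.
  (* Normalize [w1] and [w2] by their masses; a block of mass 0 contributes 0,
     and [v1 = 0] or [v2 = 0] is then admissible. *)
  have [v1 v1r ->] : exists2 v, normc v <= r & w1 = a%:C * v.
    have [a0|a_neq0] := eqVneq a 0.
      exists 0; rewrite ?normc0 // a0 mul0r; apply: eq0_normc; apply: le_anti.
      by rewrite normc_ge0 andbT (le_trans w1a) // a0 mulr0.
    exists (a^-1%:C * w1); last by rewrite mulrA -realcM mulfV // mul1r.
    rewrite normcM normc_real ?invr_ge0 // mulrC ler_pdivrMr //.
    by rewrite lt_neqAle eq_sym a_neq0.
  have [v2 v2E ->] : exists2 v, normc v + normc (v - h%:C) <= 1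
      & w2 = (1 - a)%:C * v.
    have a'_ge0 : 0 <= 1 - a by rewrite subr_ge0.
    move: (1 - a) a'_ge0 w2a => k k_ge0 w2k.
    have [k0|k_neq0] := eqVneq k 0.
      exists 0; first by rewrite normc0 sub0r normcN normc_real ?add0r // ltW.
      rewrite k0 mul0r; apply: eq0_normc; apply: le_anti.
      rewrite normc_ge0 andbT -k0; apply: le_trans w2k.
      by rewrite lerDl normc_ge0.
    have k_gt0 : 0 < k by rewrite lt_neqAle eq_sym k_neq0.
    exists (k^-1%:C * w2); last by rewrite mulrA -realcM mulfV // mul1r.
    have -> : k^-1%:C * w2 - h%:C = k^-1%:C * (w2 - (h * k)%:C).
      by rewrite mulrBr -realcM mulrC mulrCA mulVf // mulr1 mulrC.
    rewrite !normcM normc_real ?invr_ge0 // -mulrDr mulrC.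
    by rewrite ler_pdivrMr // mul1r.
  apply: convex_hull_conv; rewrite ?a_ge0 //.
    exact: hullC.
  exact: hullE.
apply: smallest_sub z; first exact: convex_join_range.
move=> z [|]; last first.
  rewrite /origin_circle /= normr_normc => /complexI zr.
  by apply: disk_sub_join; rewrite zr.
rewrite /ellipse; case: ifP => _ /=.
  case=> ->; apply: elliptical_disk_sub_join.
    by rewrite normc0 sub0r normcN normc_real ?add0r // ltW.
  by rewrite subrr normc0 addr0 normc_real // ltW.
rewrite subr0 !normr_normc -rmorphD => /complexI z1.
by apply: elliptical_disk_sub_join; rewrite z1.
Qed.

Lemma join_range_sub_disk (R : realType) (h r : R) (z : R[i]) :
  0 <= h -> (1 + h) / 2 <= r -> join_range h r z -> normc z <= r.
Proof.
move=> h_ge0 hr [a [w1 [w2 [/andP[a_ge0 a_le1] w1a w2a ->]]]].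
apply: le_trans (le_normcD _ _) _.
have : normc w2 <= normc (w2 - (h * (1 - a))%:C) + h * (1 - a).
  rewrite -[X in _ <= _ + X]normc_real ?mulr_ge0 ?subr_ge0 //.
  by apply: le_trans (le_normcD _ _); rewrite subrK.
by nra.
Qed.

Lemma join_range_Im (R : realType) (h r : R) (z : R[i]) :
  1 <= 2 * r -> join_range h r z -> `|complex.Im z| <= r.
Proof.
move=> r_ge [a [w1 [w2 [/andP[a_ge0 a_le1] w1a w2a ->]]]].
have n1 := normc_ge_absIm w1; have n2 := normc_ge_absIm w2.
have n3 : `|complex.Im w2| <= normc (w2 - (h * (1 - a))%:C).
  have -> : complex.Im w2 = complex.Im (w2 - (h * (1 - a))%:C).
    by case: (w2) => x y /=; rewrite subr0.
  exact: normc_ge_absIm.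
have -> : complex.Im (w1 + w2) = complex.Im w1 + complex.Im w2.
  by case: (w1) (w2) => [x1 y1] [x2 y2].
by apply: le_trans (ler_normD _ _) _; nra.
Qed.

Lemma join_range_not_disk (R : realType) (h r : R) :
    0 < h <= 1 -> 1 <= 2 * r -> 2 * r < 1 + h ->
  ~ exists (p : R[i]) (s : R), join_range h r = closed_disk p s.
Proof.
move=> /andP[h_gt0 h_le1] r_ge r_lt [[p1 p2] [s WE]].
have r_ge0 : 0 <= r by lra.
have W_disk z : join_range h r z <-> normc (z - (p1 +i* p2)) <= s.
  by rewrite WE /closed_disk /= normr_normc lecR.
have /W_disk top : join_range h r (0 +i* r).
  by apply: disk_sub_join; rewrite normc_imag ger0_norm.
have /W_disk bot : join_range h r (0 -i* r).
  by apply: disk_sub_join; rewrite normc_imag normrN ger0_norm.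
have s_ge0 : 0 <= s by apply: le_trans top; exact: normc_ge0.
(* The top and bottom points of the disk lie in the strip [|Im z| <= r]. *)
have topIm : `|p2 + s| <= r.
  apply: (@join_range_Im _ h r (p1 +i* (p2 + s))) => //; apply/W_disk => /=.
  by rewrite subrr expr0n add0r [p2 + _]addrC addrK sqrtr_sqr ger0_norm.
have botIm : `|p2 - s| <= r.
  apply: (@join_range_Im _ h r (p1 +i* (p2 - s))) => //; apply/W_disk => /=.
  by rewrite subrr expr0n add0r [p2 + _]addrC addrK sqrtr_sqr normrN ger0_norm.
have sqr_le (z : R[i]) : normc z <= s -> normc z ^+ 2 <= s ^+ 2.
  by move=> zs; rewrite lerXn2r ?nnegrE ?normc_ge0.
have := normc_ge_absIm (0 +i* r - (p1 +i* p2)).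
have := normc_ge_absIm (0 -i* r - (p1 +i* p2)).
have := sqr_le _ top; rewrite sqr_normc_ReIm; move: top bot topIm botIm => /=.
rewrite !ler_norml => top bot /andP[t1 t2] /andP[b1 b2] top2.
move=> /andP[c1 c2] /andP[d1 d2].
have p20 : p2 = 0 by lra.
have sr : s = r by lra.
have p10 : p1 = 0.
  by apply/eqP; rewrite -sqrf_eq0; apply/eqP; have := sqr_ge0 p1; nra.
(* The right vertex of the ellipse. *)
have /W_disk : join_range h r ((1 + h) / 2)%:C.
  apply: elliptical_disk_sub_join; rewrite -rmorphB normc_real; last by lra.
  rewrite (_ : (1 + h) / 2 - h = (1 - h) / 2); last by field.
  by rewrite normc_real; lra.
rewrite p10 p20 sr subr0 normc_real; last by lra.
by lra.
Qed.

Theorem corollary8p3 (R : realType) (b c d e f g h : R)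
  (hb : 0 <= b) (hc : 0 <= c) (hd : 0 <= d) (he : 0 <= e) (hh : 0 <= h)
  (hf0 : c * e = 0 -> 0 <= f) (hf1 : c * e <> 0 -> f <= 0)
  (hbcd : b ^+ 2 + c ^+ 2 + d ^+ 2 = 1)
  (hefgh : e ^+ 2 + f ^+ 2 + g ^+ 2 + h ^+ 2 = 1)
  (hcedf : c * e + d * f = 0)
  (hec : e = 0 -> c = 0)
  (hh0 : h <> 0) (hd0 : d <> 0) (hc0 : c = 0) (hg0 : g = 0) :
  let W := numerical_range (matrixA b c d e f g h) in
  let r := Num.sqrt (1 + d) / 2 in
  let E := ellipse 0 h%:C 1 in
  (2 * h + h ^+ 2 <= d -> W = closed_disk 0 r) /\
  (d < 2 * h + h ^+ 2 ->
     W = convex_hull (E `|` origin_circle r) /\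
     ~ (exists (p : R[i]) (s : R), W = closed_disk p s)).
Proof.
move=> W r E.
have f0 : f = 0.
  by apply: (mulfI (introN eqP hd0)); rewrite mulr0 -[RHS]hcedf hc0 mul0r add0r.
have eh1 : e ^+ 2 + h ^+ 2 = 1 by rewrite -hefgh f0 hg0 expr0n /= !addr0.
have bd1 : b ^+ 2 + d ^+ 2 = 1 by rewrite -hbcd hc0 expr0n /= addr0.
have h_gt0 : 0 < h by rewrite lt_neqAle hh andbT eq_sym; apply/eqP.
have h_le1 : h <= 1 by rewrite -(@expr_le1 _ 2) // -eh1 lerDr sqr_ge0.
have WE : W = join_range h r.
  by rewrite /W hc0 f0 hg0; exact: numerical_range_join.
have r2 : (2 * r) ^+ 2 = 1 + d.
  by rewrite /r mulrC divfK ?pnatr_eq0 // sqr_sqrtr //; lra.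
have r_ge0 : 0 <= r by rewrite /r divr_ge0 ?sqrtr_ge0.
clearbody r; rewrite WE; split=> [hd_le|hd_lt].
  apply/seteqP; split=> z; rewrite /closed_disk /= subr0 normr_normc lecR.
    apply: join_range_sub_disk => //.
    have : 1 + h <= 2 * r.
      by rewrite -ler_sqr ?nnegrE; [rewrite r2; nra|lra|lra].
    by lra.
  exact: disk_sub_join.
split; first by apply: join_range_hull; rewrite ?h_gt0.
apply: join_range_not_disk; first by rewrite h_gt0.
  by rewrite -ler_sqr ?nnegrE; [rewrite r2; nra|lra|lra].
by rewrite -ltr_sqr ?nnegrE; [rewrite r2; nra|lra|lra].
Qed.
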